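(* Let $T$ be a (finite) tree. Then the $3$-path free complex of $T$ is vertex decomposable.
   Context: Graphs are finite and simple. For a graph $G$ and $A\subseteq V(G)$, $G[A]$ denotes the induced subgraph on $A$. A tree is a connected graph in which there is a unique path between every pair of distinct vertices. The $t$-path free complex of a graph $G$ is the simplicial complex whose faces are the subsets $A\subseteq V(G)$ inducing no path on $t$ vertices, i.e. such that $G[A]$ contains no path on $t$ vertices, where a path is a sequence of distinct vertices with consecutive ones adjacent. A simplicial complex $\Delta$ on a finite vertex set is a collection of subsets (faces) closed under taking subsets; facets are the inclusion-maximal faces. The empty complex $\{\emptyset\}$ has only the empty face, and the void complex $\emptyset$ has no faces. A simplex is a complex with exactly one facet. For a vertex $v$ of $\Delta$: $\mathrm{lk}_\Delta(v)=\{F\in\Delta : v\notin F,\ F\cup\{v\}\in\Delta\}$ and $\mathrm{del}_\Delta(v)=\{F\in\Delta : v\notin F\}$. $\Delta$ is vertex decomposable if either $\Delta$ is a simplex (including the cases $\emptyset$ and $\{\emptyset\}$), or there exists a vertex $v$ of $\Delta$ such that both $\mathrm{lk}_\Delta(v)$ and $\mathrm{del}_\Delta(v)$ are vertex decomposable and each facet of $\mathrm{del}_\Delta(v)$ is a facet of $\Delta$ (recursive definition; $\Delta$ is not required to be pure). *)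

(* Defs.v *)
From mathcomp Require Import all_boot.

Set Implicit Arguments.
Unset Strict Implicit.
Unset Printing Implicit Defensive.

Section Graphs.

Variables (V : finType) (e : rel V).

Definition simple_graph : Prop := symmetric e /\ irreflexive e.

Definition connected_graph : Prop := forall x y : V, connect e x y.

(* [x :: p] lists the vertices of the path. *)
Definition path_between (x y : V) (p : seq V) : Prop :=
  [/\ path e x p, uniq (x :: p) & last x p = y].

Definition tree : Prop :=
  [/\ simple_graph, connected_graph
    & forall x y : V, x != y -> exists! p : seq V, path_between x y p].

(* The adjacency of the induced subgraph on [A] is the restriction of [e], so a
   path of it is a path of the whole graph with all its vertices in [A].  The
   path need not be an induced one. *)
Definition contains_path (t : nat) (A : {set V}) : bool :=
  [exists p : t.-tuple V, [&& uniq p, sorted e p & all [in A] p]].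

Definition path_free_complex (t : nat) : {set {set V}} :=
  [set A | ~~ contains_path t A].

End Graphs.

Section Complexes.

Variable V : finType.
Implicit Types (D : {set {set V}}) (F : {set V}) (v : V).

Definition simplicial_complex D : Prop :=
  forall F F' : {set V}, F \in D -> F' \subset F -> F' \in D.

Definition facets D : {set {set V}} := [set F | maxset [in D] F].

Definition simplex D : Prop := #|facets D| = 1.

Definition link D v : {set {set V}} :=
  [set F in D | (v \notin F) && (v |: F \in D)].

Definition deletion D v : {set {set V}} := [set F in D | v \notin F].

(* The void complex has no facet, hence its separate clause; [simplex] covers
   the complex [[set set0]].  The complexes live on subsets of the fixed type
   [V], but the vertices of [D] are only the [v] with [[set v] \in D]. *)
Inductive vertex_decomposable D : Prop :=
| VdVoid of D = set0
| VdSimplex of simplex D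
| VdShed v of [set v] \in D
    & vertex_decomposable (link D v)
    & vertex_decomposable (deletion D v)
    & facets (deletion D v) \subset facets D.

Lemma link_complex D v : simplicial_complex D -> simplicial_complex (link D v).
Proof.
move=> cD F F'; rewrite !inE => /and3P[DF vF DvF] sF'F.
rewrite (cD _ _ DF sF'F) (contra (subsetP sF'F v) vF) /=.
exact: cD DvF (setUS _ sF'F).
Qed.

Lemma deletion_complex D v :
  simplicial_complex D -> simplicial_complex (deletion D v).
Proof.
move=> cD F F'; rewrite !inE => /andP[DF vF] sF'F.
by rewrite (cD _ _ DF sF'F) (contra (subsetP sF'F v) vF).
Qed.

Lemma path_free_complexP (e : rel V) (t : nat) :
  simplicial_complex (path_free_complex e t).
Proof.
move=> F F'; rewrite !inE => nF sF'F; apply: contra nF.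
case/existsP=> p /and3P[Up ep /allP pF']; apply/existsP; exists p.
by rewrite Up ep; apply/allP=> x /pF' /(subsetP sF'F).
Qed.

End Complexes.

(* Main.v *)
Require Import Defs.
From mathcomp Require Import all_boot.

Set Implicit Arguments.
Unset Strict Implicit.
Unset Printing Implicit Defensive.

(** Every complex obtained from the 3-path free complex of a tree by links and
    deletions has the form {F subset of W : F u S has no 3-path}, so it is enough
    to find a shedding vertex in each of these complexes that is not a simplex.
    The end of a longest path of the forest induced on S u W provides a leaf l,
    its neighbour p and a further neighbour g of p such that all neighbours of p
    other than g are leaves; then g or p is a shedding vertex, because a face that
    can be extended by it can also be extended by a leaf at p or by p. *)

(** * Links, deletions and shedding vertices of a simplicial complex *)

Section Minors.

Variable V : finType.
Implicit Types (D : {set {set V}}) (F S W : {set V}) (v w : V).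

(** [S] collects the vertices whose link has been taken, [W] those still available. *)
Definition minor D S W : {set {set V}} :=
  [set F : {set V} | (F \subset W) && (F :|: S \in D)].

Lemma minor0T D : minor D set0 setT = D.
Proof. by apply/setP=> F; rewrite inE subsetT setU0. Qed.

Lemma minor_complex D S W :
  simplicial_complex D -> simplicial_complex (minor D S W).
Proof.
move=> cD F F'; rewrite !inE => /andP[FW FD] F'F.
by rewrite (subset_trans F'F FW) (cD _ _ FD) // setSU.
Qed.

Lemma minor_void D S W :
  simplicial_complex D -> S \notin D -> minor D S W = set0.
Proof.
move=> cD nS; apply/setP=> F; rewrite !inE; apply: contraNF nS => /andP[_].
by move/cD; apply; apply: subsetUr.
Qed.

Lemma minor_simplex D S W :
  simplicial_complex D -> W :|: S \in D -> simplex (minor D S W).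
Proof.
move=> cD DWS; apply/eqP/cards1P; exists W; apply/setP=> F; rewrite !inE.
apply/maxsetP/eqP=> [[/= FD maxF]|->].
  rewrite -(maxF W) //; first by rewrite /= inE subxx.
  by move: FD; rewrite inE => /andP[].
split=> [|B]; rewrite /= inE ?subxx // => /andP[BW _] WB.
by apply/eqP; rewrite eqEsubset BW.
Qed.

Lemma minor_nonvertex D S W v :
    simplicial_complex D -> v |: S \notin D ->
  minor D S W = minor D S (W :\ v).
Proof.
move=> cD nv; apply/setP=> F; rewrite !inE subsetD1.
case FD: (F :|: S \in D); rewrite ?andbF // !andbT.
suff ->: v \notin F by rewrite andbT.
apply: contra nv => vF; apply: cD FD _.
by rewrite setSU // sub1set.
Qed.

Lemma deletion_minor D S W v :
  deletion (minor D S W) v = minor D S (W :\ v).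
Proof. by apply/setP=> F; rewrite !inE subsetD1 andbAC. Qed.

Lemma link_minor D S W v :
    simplicial_complex D -> v \in W ->
  link (minor D S W) v = minor D (v |: S) (W :\ v).
Proof.
move=> cD vW; apply/setP=> F; rewrite !inE subsetD1 subUset sub1set vW /=.
rewrite -(setUA [set v]) (setUCA [set v] F).
case: (F \subset W) => //=; case: (v \notin F); rewrite ?andbF ?andbT //=.
case vD: (F :|: (v |: S) \in D); rewrite ?andbF ?andbT //.
by apply: cD vD _; rewrite setUS // subsetUr.
Qed.

(** Exchange form of the facet condition in [VdShed]: no face of the link of [v] is a facet of the
    deletion. *)
Definition sheds D S W v : Prop :=
  forall F, F \subset W :\ v -> v |: (F :|: S) \in D ->
  exists w, [/\ w \in W, w != v, w \notin F & w |: (F :|: S) \in D].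

Lemma facets_deletion_minor D S W v :
    simplicial_complex D -> sheds D S W v ->
  facets (deletion (minor D S W) v) \subset facets (minor D S W).
Proof.
rewrite deletion_minor => cD shv.
apply/subsetP=> F; rewrite inE => /maxsetP[/=].
rewrite !inE => /andP[FW FD] maxF.
have FW' : F \subset W by move: FW; rewrite subsetD1 => /andP[].
apply/maxsetP; rewrite /= inE FW' FD; split=> // B; rewrite /= inE.
move=> /andP[BW BD] FB; apply: (maxF) => //=.
(* If [B] contained [v], then [F] would lie in the link of [v], and the exchange vertex would
   enlarge [F] inside the deletion. *)
rewrite inE BD andbT subsetD1 BW /=; apply/negP=> vB.
have [|w [wW wv wF wD]] := shv F FW.
  by apply: cD BD _; rewrite setUA setSU // subUset sub1set vB.
case/negP: wF; rewrite -(maxF (w |: F)) ?setU11 ?subsetUr //=.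
by rewrite inE -setUA wD subUset FW sub1set !inE wv wW.
Qed.

Lemma vertex_decomposable_minor D S W :
    simplicial_complex D ->
    (forall S W, S \in D ->
       {in W, forall v, v |: S \in D} -> W :|: S \notin D ->
       exists2 v, v \in W & sheds D S W v) ->
  vertex_decomposable (minor D S W).
Proof.
move=> cD shedD; have [n] := ubnP #|W|.
elim: n S W => // n IHn S W; rewrite ltnS => leWn.
have IHv v : v \in W -> #|W :\ v| < n.
  by move=> vW; rewrite [#|W|](cardsD1 v) vW in leWn.
have [DS|nDS] := boolP (S \in D); last by apply: VdVoid; apply: minor_void.
have [DWS|nDWS] := boolP (W :|: S \in D).
  by apply: VdSimplex; apply: minor_simplex.
(* An element of [W] that is not a vertex of the minor is discarded, so [shedD] is only called when
   every element of [W] is a vertex. *)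
have [/forall_inP vD|/forall_inPn[v vW nvD]] :=
  boolP [forall v in W, v |: S \in D]; last first.
  by rewrite (minor_nonvertex W cD nvD); apply: IHn; apply: IHv.
have [v vW shv] := shedD S W DS vD nDWS.
apply: (@VdShed _ _ v).
- by rewrite inE sub1set vW vD.
- by rewrite link_minor //; apply: IHn; apply: IHv.
- by rewrite deletion_minor; apply: IHn; apply: IHv.
- exact: facets_deletion_minor.
Qed.

End Minors.

(** * 3-path free vertex sets in a tree *)

Section ThreePathFree.

Variables (V : finType) (e : rel V).
Hypothesis e_tree : tree e.
Implicit Types (A F S W U : {set V}).

Let esym : symmetric e. Proof. by case: e_tree => [[]]. Qed.
Let eirr : irreflexive e. Proof. by case: e_tree => [[]]. Qed.

Lemma contains_pathP t A :
  reflect (exists p : seq V,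
             [/\ size p = t, uniq p, sorted e p & {subset p <= A}])
          (contains_path e t A).
Proof.
apply: (iffP existsP) => [[p /and3P[Up ep /allP pA]]|[p [<- Up ep pA]]].
  by exists p; rewrite size_tuple.
by exists (in_tuple p); apply/and3P; split=> //; apply/allP.
Qed.

(** Irreflexivity separates consecutive vertices, so a walk [x], [y], [z] fails to be a path only
    when [x = z]. In other words, the induced graph is a matching plus isolated vertices. *)
Lemma path3_freeP A :
  reflect (forall x y z, x \in A -> y \in A -> z \in A ->
             e x y -> e y z -> x = z)
          (A \in path_free_complex e 3).
Proof.
rewrite inE; apply: (iffP idP) => [nA x y z xA yA zA exy eyz|fA].
  apply: contraNeq nA => xz; apply/contains_pathP; exists [:: x; y; z].
  have neq u v : e u v -> u != v by apply: contraTneq => ->; rewrite eirr.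
  split=> // [||u]; first by rewrite /= !inE negb_or xz !neq.
    by rewrite /= exy eyz.
  by rewrite !inE => /or3P[] /eqP->.
apply/negP=> /contains_pathP[p []]; case: p => [|x [|y [|z []]]] //= _.
rewrite !inE negb_or => /and3P[/andP[_ /eqP xz] _ _] /and3P[exy eyz _] pA.
by case: xz; apply: (fA _ y) => //; apply: pA; rewrite !inE eqxx ?orbT.
Qed.

(** A new 3-path has [w] in the middle, which the second hypothesis excludes, or at an end, which
    the third excludes. *)
Lemma path3_free_add A w :
    A \in path_free_complex e 3 ->
    (forall x z, x \in A -> z \in A -> e w x -> e w z -> x = z) ->
    (forall y z, y \in A -> z \in A -> e w y -> ~~ e y z) ->
  w |: A \in path_free_complex e 3.
Proof.
move=> /path3_freeP fA w1 w2; apply/path3_freeP=> x y z.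
have ww : e w w = false by apply: eirr.
case/setU1P=> [->|xA] /setU1P[->|yA] /setU1P[->|zA] //; rewrite ?ww //.
- by move=> wy yz; have := w2 y z yA zA wy; rewrite yz.
- by rewrite esym => wx wz; apply: w1.
- by move=> xy; rewrite esym => wy; have := w2 y x yA xA wy; rewrite esym xy.
- exact: fA.
Qed.

(** The edge from [x] to [z] and the initial segment of the path up to [z] both join [x] to [z], so
    they coincide by uniqueness of paths. Since [z] is in [q], the default of [head] is never
    reached. *)
Lemma neighbour_on_path x z q :
  uniq (x :: q) -> path e x q -> z \in q -> e x z -> z = head x q.
Proof.
move=> Uq eq zq exz.
have xz : x != z by apply: contraTneq exz => ->; rewrite eirr.
case: e_tree => _ _ /(_ x z xz)[p0 [_ uniqp]].
case/path.splitP: zq Uq eq => q1 q2 Uq eq.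
have p1 : p0 = [:: z].
  by apply: uniqp; split; rewrite //= ?exz // inE xz.
have: p0 = rcons q1 z.
  apply: uniqp; split; rewrite ?last_rcons //.
    by move: eq; rewrite cat_path => /andP[].
  by move: Uq; rewrite -cat_cons cat_uniq => /andP[].
by rewrite p1; case: q1 {Uq eq uniqp} => [|? []].
Qed.

(** A neighbour of [x] off the path would lengthen it; one on the path is the next vertex, by
    [neighbour_on_path]. *)
Lemma longest_path_head U x q :
    (forall p, uniq p -> sorted e p -> {subset p <= U} ->
       size p <= size (x :: q)) ->
    uniq (x :: q) -> path e x q -> {subset x :: q <= U} ->
  forall z, z \in U -> e x z -> z = head x q.
Proof.
move=> maxq Uq eq qU z zU exz; apply: neighbour_on_path => //.
have xz : x != z by apply: contraTneq exz => ->; rewrite eirr.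
have [|zq] := boolP (z \in x :: q); first by rewrite inE eq_sym (negPf xz).
suff: size (z :: x :: q) <= size (x :: q) by rewrite ltnn.
apply: maxq; first by rewrite cons_uniq zq.
  by rewrite /= esym exz.
by move=> u; rewrite inE => /predU1P[->|/qU].
Qed.

Lemma pendant_star U :
    U \notin path_free_complex e 3 ->
  exists l p g, [/\ [/\ l \in U, p \in U & g \in U], [/\ e l p, e p g & l != g],
    forall z, z \in U -> e l z -> z = p &
    forall y z, y \in U -> z \in U -> e p y -> y != g -> e y z -> z = p].
Proof.
rewrite inE negbK => U3.
have bound n : contains_path e n U -> n <= #|V|.
  by case/contains_pathP=> p [<- /card_uniqP <- _ _]; apply: max_card.
case: (ex_maxnP (ex_intro _ 3 U3) bound) => n Un maxn.
have := maxn 3 U3; case/contains_pathP: Un => s [sz].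
case: s sz => [|l [|p [|g q]]] /= sz; rewrite -?sz // => Us es sU _.
have maxs r : uniq r -> sorted e r -> {subset r <= U} -> size r <= (size q).+3.
  by move=> Ur er rU; rewrite sz; apply: maxn; apply/contains_pathP; exists r.
have [lU pU gU] : [/\ l \in U, p \in U & g \in U].
  by split; apply: sU; rewrite !inE eqxx ?orbT.
have [lp pg eq] := and3P es; have lg : l != g.
  by move: Us; rewrite /= !inE !negb_or => /andP[/and3P[]].
have lhead := @longest_path_head U l [:: p, g & q] maxs Us es sU.
exists l, p, g; split=> // y z yU zU py yg yz.
have Up : uniq [:: p, g & q] by case/andP: Us.
have yp : y != p by apply: contraTneq py => ->; rewrite eirr.
have yq : y \notin g :: q.
  by apply: contraNN yg => /(neighbour_on_path Up)->; rewrite //= pg.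
(* Replacing [l] by [y] gives a path of the same, maximal length, so [y] is a leaf for the same
   reason as [l]. *)
apply: (@longest_path_head U y [:: p, g & q]) => //.
- by rewrite cons_uniq Up andbT inE negb_or yp.
- by rewrite /= esym py pg.
- move=> u; rewrite inE => /predU1P[->//|uq].
  by apply: sU; rewrite inE uq orbT.
Qed.

Lemma path3_free_shedding S W :
    S \in path_free_complex e 3 ->
    {in W, forall v, v |: S \in path_free_complex e 3} ->
    W :|: S \notin path_free_complex e 3 ->
  exists2 v, v \in W & sheds (path_free_complex e 3) S W v.
Proof.
move=> SD vD /pendant_star[l [p [g [[lU pU gU] [lp pg lg] leafl leafp]]]].
have neq u v : e u v -> u != v by apply: contraTneq => ->; rewrite eirr.
have subU F v u : F \subset W :\ v -> u \in F :|: S -> u \in W :|: S.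
  rewrite subsetD1 => /andP[/subsetP FW _].
  by rewrite !inE => /orP[/FW|] ->; rewrite ?orbT.
have inW u : u \in W :|: S -> u \notin S -> u \in W.
  by rewrite inE => /orP[//|->].
have [pS|pS] := boolP (p \in S).
  (* With [p] in [S], neither [l] nor [g] is in [S]: otherwise [S] with at most one vertex of [W]
     would contain the path [l], [p], [g]. *)
  have lS : l \notin S.
    apply/negP=> lS; have [gS|gS] := boolP (g \in S).
      by case/eqP: lg; apply: (path3_freeP _ SD l p g).
    case/eqP: lg; apply: (path3_freeP _ (vD g (inW g gU gS)) l p g);
      by rewrite ?inE ?eqxx ?lS ?pS ?orbT.
  have lW := inW l lU lS.
  have gS : g \notin S.
    apply/negP=> gS; case/eqP: lg.
    by apply: (path3_freeP _ (vD l lW) l p g); rewrite ?inE ?eqxx ?gS ?pS ?orbT.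
  (* [g] sheds with substitute [l]: the edge from [p] to [g] leaves [p] no neighbour in [F :|: S],
     and [l] attaches only to [p]. *)
  exists g => [|F FW FgD]; first exact: inW.
  have FD : F :|: S \in path_free_complex e 3.
    by apply: path_free_complexP FgD _; apply: subsetUr.
  have gF : g \notin F by move: FW; rewrite subsetD1 => /andP[].
  have noF u : u \in F :|: S -> ~~ e p u.
    move=> uFS; apply/negP=> pu.
    have ug : u = g.
      apply: (path3_freeP _ FgD u p g) => //; rewrite 1?esym //.
      - by rewrite setU1r.
      - by rewrite !inE pS !orbT.
      - by rewrite setU11.
    by move: uFS; rewrite ug inE (negPf gF) (negPf gS).
  exists l; split=> //.
    by apply/negP=> lF; have := noF l; rewrite inE lF esym lp => /(_ isT).
  have onlyp u : u \in F :|: S -> e l u -> u = p.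
    by move=> uFS; apply: leafl; apply: subU FW uFS.
  apply: path3_free_add => // [x z xF zF /(onlyp x xF)->|y z yF zF].
    by move/(onlyp z zF)->.
  by move/(onlyp y yF)->; apply: noF.
have pW := inW p pU pS.
(* Such a [y] is a second neighbour of [p] that lies in [S] or is itself a leaf; in both cases [p]
   sheds. *)
have [/exists_inP[y yU /and3P[py yl yleaf]]|] :=
  boolP [exists y in W :|: S, [&& e p y, y != l & (y \in S) || (y != g)]].
  exists p => // F FW FpD.
  have FD : F :|: S \in path_free_complex e 3.
    by apply: path_free_complexP FpD _; apply: subsetUr.
  have pFS : p \notin F :|: S.
    by move: FW; rewrite subsetD1 inE (negPf pS) orbF => /andP[].
  (* At most one neighbour of [p] is in [F :|: S]. So [l] is missing, or else [y] is missing, hence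
     outside [S] and a leaf. The missing leaf is isolated when added, as [p] is absent. *)
  have [w [wU wFS pw leafw]] : exists w,
      [/\ w \in W :|: S, w \notin F :|: S, e p w
      & forall z, z \in W :|: S -> e w z -> z = p].
    have [lFS|lFS] := boolP (l \in F :|: S); last by exists l; rewrite esym.
    have yFS : y \notin F :|: S.
      apply: contraNN yl => yFS; apply/eqP.
      by apply: (path3_freeP _ FpD y p l); rewrite ?setU11 ?setU1r // esym.
    have yg : y != g.
      by case/orP: yleaf => // yS; rewrite inE yS orbT in yFS.
    by exists y; split=> // z zU yz; apply: (leafp y).
  have [wF wS] : w \notin F /\ w \notin S by apply/norP; rewrite -in_setU.
  exists w; split; rewrite ?(inW w) //; first by rewrite neq // esym.
  have noFS z : z \in F :|: S -> ~~ e w z.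
    move=> zFS; apply: contraNN pFS => /(leafw z (subU F p z FW zFS)) <-.
    exact: zFS.
  by apply: path3_free_add => // [x z /noFS/negPf->|x z /noFS/negPf->].
rewrite negb_exists_in => /forall_inP onlyg.
have gS : g \notin S.
  by have := onlyg g gU; rewrite pg eq_sym lg /= => /norP[].
have lgP x : x \in W :|: S -> e p x -> x = l \/ x = g.
  move=> xU px; have := onlyg x xU; rewrite px /=.
  have [->|_] := eqVneq x l; first by left.
  by have [->|_] := eqVneq x g; [right|rewrite orbT].
(* Now [l] and [g] are the only neighbours of [p]. The substitute for [g] is [l] if [p] is present
   and [p] otherwise; its component after adding it lies within [l] and [p]. *)
exists g => [|F FW FgD]; first exact: inW.
have FD : F :|: S \in path_free_complex e 3.
  by apply: path_free_complexP FgD _; apply: subsetUr.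
have gFS : g \notin F :|: S.
  by move: FW; rewrite subsetD1 inE (negPf gS) orbF => /andP[].
have onlyl x : x \in F :|: S -> e p x -> x = l.
  move=> xFS px; case: (lgP x (subU F g x FW xFS) px) => // xg.
  by rewrite -xg xFS in gFS.
have onlyp x : x \in F :|: S -> e l x -> x = p.
  by move=> xFS; apply: leafl; apply: subU FW xFS.
have [pFS|pFS] := boolP (p \in F :|: S).
  have lFS : l \notin F :|: S.
    apply: contraNN lg => lFS; apply/eqP.
    by apply: (path3_freeP _ FgD l p g); rewrite ?setU11 ?setU1r.
  have [lF lS] : l \notin F /\ l \notin S by apply/norP; rewrite -in_setU.
  exists l; split; rewrite ?(inW l) //.
  apply: path3_free_add => // [x z xF zF /(onlyp x xF)-> /(onlyp z zF)-> //|].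
  move=> x z xF zF lx.
  rewrite (onlyp x xF lx); apply: contraNN lFS => /(onlyl z zF) <-.
  exact: zF.
have pF : p \notin F by move: pFS; rewrite inE => /norP[].
exists p; split; rewrite ?neq //.
apply: path3_free_add => // [x z xF zF /(onlyl x xF)-> /(onlyl z zF)-> //|].
move=> x z xF zF px.
rewrite (onlyl x xF px); apply: contraNN pFS => /(onlyp z zF) <-.
exact: zF.
Qed.

End ThreePathFree.

Theorem mainTheorem4 (V : finType) (e : rel V) (e_tree : tree e) :
  vertex_decomposable (path_free_complex e 3).
Proof.
rewrite -[X in vertex_decomposable X]minor0T.
apply: vertex_decomposable_minor; first exact: path_free_complexP.
exact: path3_free_shedding e_tree.
Qed.
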